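(* Let $\mathbf{D}'$ be the category of naturally ordered finite distributive lattices with positive surjective lattice homomorphisms, and let $\mathbf{P}'$ be the category of finite linearly ordered posets with poset embeddings that preserve the additional linear order. Let $\mathcal{J}':\mathbf{D}'\to\mathbf{P}'$ and $\mathcal{O}':\mathbf{P}'\to\mathbf{D}'$ be the contravariant functors given on objects by $\mathcal{J}'(\mathcal{L}_\sqsubset)=\mathcal{J}(\mathcal{L})_\sqsubset$ and $\mathcal{O}'(\mathcal{Q}_\sqsubset)=\mathcal{O}(\mathcal{Q})_\sqsubset$, and on morphisms by $\mathcal{J}'(f)=\mathcal{J}(f)$ and $\mathcal{O}'(\varphi)=\mathcal{O}(\varphi)$. Then $\mathcal{J}'$ and $\mathcal{O}'$ constitute a dual equivalence between $\mathbf{D}'$ and $\mathbf{P}'$, i.e. there are natural isomorphisms $\mathrm{ID}_{\mathbf{D}'}\to\mathcal{O}'\mathcal{J}'$ and $\mathrm{ID}_{\mathbf{P}'}\to\mathcal{J}'\mathcal{O}'$.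
   Context: Lattices have bottom $0$ and top $1$ in the signature, and homomorphisms preserve them; $\le$ (strict part $<$) denotes the lattice order. The one-element lattice and the empty poset are allowed. $J(\mathcal{L})$ is the set of join-irreducible elements of $\mathcal{L}$ ($0$ is not join-irreducible); the empty join is $0$. Natural order: let $\sqsubset^0$ be a (strict) linear order on $J(\mathcal{L})$ extending $<$ on $J(\mathcal{L})$, and write $J(\mathcal{L})=\{j_1\sqsubset^0\dots\sqsubset^0 j_n\}$. For $x\in L$ let $\delta_i(x)=1$ if $j_i\le x$ and $\delta_i(x)=0$ otherwise. The antilexicographic order $\sqsubset$ on $L$ with respect to $\sqsubset^0$ is: $x\sqsubset y$ iff there is $s$ with $\delta_s(x)<\delta_s(y)$ and $\delta_t(x)=\delta_t(y)$ for all $t>s$. A linear order on $L$ is natural if it arises this way from some such $\sqsubset^0$. A naturally ordered finite distributive lattice $\mathcal{L}_\sqsubset$ is a finite distributive lattice $\mathcal{L}$ together with a natural linear order $\sqsubset$; $\sqsubseteq$ is the reflexive version. For a lattice homomorphism $f:\mathcal{L}\to\mathcal{K}$ let $N(f)=\{x\in L : \exists y\in L\ (y<x \text{ and } f(y)=f(x))\}$, and for $x\in L$, $S\subseteq L$ let $x-S=\bigvee\{j\in J(\mathcal{L}) : j\le x,\ j\notin S\}$. A lattice homomorphism $f$ from $\mathcal{L}_\sqsubset$ to $\mathcal{K}_\prec$ is positive if for all $x,y\in L$: $x-N(f)\sqsubseteq y-N(f)$ implies $f(x)\preceq f(y)$. A linearly ordered poset $\mathcal{P}_\prec$ is a poset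 $\mathcal{P}$ together with a linear order $\prec$ extending the order of $\mathcal{P}$. Birkhoff functors: $\mathcal{J}(\mathcal{L})$ is the poset $J(\mathcal{L})$ with the restricted lattice order, and for a homomorphism $f:\mathcal{L}\to\mathcal{K}$, $\mathcal{J}(f):\mathcal{J}(\mathcal{K})\to\mathcal{J}(\mathcal{L})$ is $\mathcal{J}(f)(y)=\bigwedge f^{-1}(\{z\in K: z\ge y\})$. $\mathcal{O}(\mathcal{Q})$ is the lattice of down-sets of the poset $\mathcal{Q}$ under union and intersection, and for a poset homomorphism $\varphi:\mathcal{P}\to\mathcal{Q}$, $\mathcal{O}(\varphi):\mathcal{O}(\mathcal{Q})\to\mathcal{O}(\mathcal{P})$ is $U\mapsto\varphi^{-1}(U)$. $\mathcal{J}(\mathcal{L})_\sqsubset$ is $\mathcal{J}(\mathcal{L})$ with the restriction of $\sqsubset$ to $J(\mathcal{L})$. For a linearly ordered poset $\mathcal{Q}_\sqsubset$, $\mathcal{O}(\mathcal{Q})_\sqsubset$ is $\mathcal{O}(\mathcal{Q})$ with the natural order obtained by transferring $\sqsubset$ to the join-irreducibles of $\mathcal{O}(\mathcal{Q})$ via $q\mapsto\{p: p\le q\}$ and extending antilexicographically. *)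

(* Defs.v *)
From HB Require Import structures.
From mathcomp Require Import all_boot all_order.
From mathcomp Require Import boolp.

Set Implicit Arguments.
Unset Strict Implicit.
Unset Printing Implicit Defensive.

Import Order.TTheory.
Local Open Scope order_scope.

Record category := Category {
  obj :> Type;
  hom : obj -> obj -> Type;
  idm : forall a, hom a a;
  compm : forall a b c, hom b c -> hom a b -> hom a c;
  compmA : forall a b c e (h : hom c e) (g : hom b c) (f : hom a b),
    compm h (compm g f) = compm (compm h g) f;
  comp1m : forall a b (f : hom a b), compm (idm b) f = f;
  compm1 : forall a b (f : hom a b), compm f (idm a) = f
}.
Arguments hom : clear implicits.
Arguments idm {c} a : rename.
Arguments compm {c a b c0} g f : rename.

Definition isomorphism (C : category) (a b : C) (f : hom C a b) : Prop :=
  exists g : hom C b a, compm g f = idm a /\ compm f g = idm b.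

(* A functor structure over a prescribed object map F0. *)
Record functor (C D : category) (F0 : C -> D) := Functor {
  fmap :> forall a b, hom C a b -> hom D (F0 a) (F0 b);
  fmap_id : forall a, fmap (idm a) = idm (F0 a);
  fmap_comp : forall a b c (g : hom C b c) (f : hom C a b),
    fmap (compm g f) = compm (fmap g) (fmap f)
}.
Arguments functor : clear implicits.
Arguments fmap {C D F0} F {a b} f : rename.

Record contrafunctor (C D : category) (F0 : C -> D) := ContraFunctor {
  cmap :> forall a b, hom C a b -> hom D (F0 b) (F0 a);
  cmap_id : forall a, cmap (idm a) = idm (F0 a);
  cmap_comp : forall a b c (g : hom C b c) (f : hom C a b),
    cmap (compm g f) = compm (cmap f) (cmap g)
}.
Arguments contrafunctor : clear implicits.
Arguments cmap {C D F0} F {a b} f : rename.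

Definition id_functor (C : category) : functor C C (fun a => a) :=
  @Functor C C (fun a => a) (fun a b f => f) (fun a => erefl)
    (fun a b c g f => erefl).

Section ContraComp.
Variables (C D E : category) (F0 : C -> D) (G0 : D -> E).
Variables (G : contrafunctor D E G0) (F : contrafunctor C D F0).

Fact contra_comp_id a : cmap G (cmap F (idm a)) = idm (G0 (F0 a)).
Proof. by rewrite !cmap_id. Qed.

Fact contra_comp_comp a b c (g : hom C b c) (f : hom C a b) :
  cmap G (cmap F (compm g f)) =
  compm (cmap G (cmap F g)) (cmap G (cmap F f)).
Proof. by rewrite !cmap_comp. Qed.

Definition contra_comp : functor C E (fun a => G0 (F0 a)) :=
  @Functor C E (fun a => G0 (F0 a)) (fun a b f => cmap G (cmap F f))
    contra_comp_id contra_comp_comp.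
End ContraComp.

Definition naturally_isomorphic (C D : category) (F0 G0 : C -> D)
    (F : functor C D F0) (G : functor C D G0) : Prop :=
  exists eta : forall a, hom D (F0 a) (G0 a),
    (forall a b (f : hom C a b),
       compm (fmap G f) (eta a) = compm (eta b) (fmap F f)) /\
    (forall a, isomorphism (eta a)).

Definition strict_linear (T : eqType) (r : rel T) : Prop :=
  [/\ irreflexive r, transitive r & forall x y, x != y -> r x y || r y x].

Definition refl_clos (T : eqType) (r : rel T) : rel T :=
  fun x y => (x == y) || r x y.

Definition linear_extension d (P : finPOrderType d) (r : rel P) : Prop :=
  strict_linear r /\ (forall x y : P, x < y -> r x y).

Definition join_irreducible d (L : finTBDistrLatticeType d) (x : L) : bool :=
  (x != \bot) &&
  [forall a : L, forall b : L, (x == a `|` b) ==> (x == a) || (x == b)].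

Section JoinIrr.
Context d (L : finTBDistrLatticeType d).

Record join_irr := JoinIrr {
  ji_val :> L;
  ji_valP : join_irreducible ji_val
}.

HB.instance Definition _ := [isSub for ji_val].
HB.instance Definition _ := [Finite of join_irr by <:].
HB.instance Definition _ := [SubChoice_isSubPOrder of join_irr by <: with d].

Lemma join_irrP (x : L) :
  reflect (x <> \bot /\ forall a b, x = a `|` b -> x = a \/ x = b)
          (join_irreducible x).
Proof.
apply: (iffP andP) => -[x0 xP]; split.
- by apply/eqP.
- move=> a b /eqP xab; move/forallP: xP => /(_ a) /forallP /(_ b).
  by rewrite xab /= => /orP[] /eqP; [left | right].
- by apply/eqP.
- apply/forallP => a; apply/forallP => b; apply/implyP => /eqP /xP[] ->.
    by rewrite eqxx.
  by rewrite eqxx orbT.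
Qed.

Lemma ji_decomp (x y : L) :
  (forall j : join_irr, val j <= x -> val j <= y) -> x <= y.
Proof.
have [n] := ubnP #|[set z : L | z < x]|; elim: n x => // n IH x /ltnSE cx xy.
have [xJ|] := boolP (join_irreducible x).
  exact: (xy (JoinIrr xJ)).
rewrite negb_and negbK => /orP[/eqP ->|]; first exact: le0x.
rewrite negb_forall => /existsP[a]; rewrite negb_forall => /existsP[b].
rewrite negb_imply negb_or => /andP[/eqP xab /andP[xa xb]].
have ax : a < x by rewrite lt_def xa xab leUl.
have bx : b < x by rewrite lt_def xb xab leUr.
have sub c : c < x -> c <= y.
  move=> cx'; apply: IH => [|j jc]; last exact/xy/(le_trans jc)/ltW.
  apply: leq_trans cx; apply: proper_card; apply/properP; split.
    by apply/fintype.subsetP => z; rewrite !inE => /lt_trans; apply.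
  by exists c; rewrite !inE // ltxx.
by rewrite xab leUx !sub.
Qed.

Lemma join_irr_join (j : L) (I : finType) (P : pred I) (F : I -> L) :
  join_irreducible j -> j = \join_(i | P i) F i -> exists2 i, P i & j = F i.
Proof.
move=> /join_irrP[j0 jP].
elim/big_rec: _ => [|i x Pi IH /jP[]]; first by move/j0.
- by exists i.
- exact: IH.
Qed.

End JoinIrr.

Section NaturalOrder.
Context d (L : finTBDistrLatticeType d).

Definition delta (j : join_irr L) (x : L) : nat := ((val j <= x)%O : bool).

(* "t > s" on indices of the enumeration j_1, ..., j_n of the join-irreducibles
   is the relation [r0 s t] on the join-irreducibles themselves. *)
Definition antilex (r0 : rel (join_irr L)) : rel L := fun x y =>
  [exists s : join_irr L, (delta s x < delta s y)%N &&
    [forall t : join_irr L, r0 s t ==> (delta t x == delta t y)]].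

Definition natural_order (r : rel L) : Prop :=
  exists2 r0 : rel (join_irr L), linear_extension r0 & r =2 antilex r0.

Lemma strict_linear_max (T : finType) (r : rel T) (P : pred T) (x0 : T) :
  strict_linear r -> P x0 ->
  exists2 s, P s & forall t, r s t -> ~~ P t.
Proof.
move=> [irr tr tot] Px0.
have [n] := ubnP #|[set t | r x0 t]|; elim: n x0 Px0 => // n IH x Px /ltnSE cx.
have [/existsP[t /andP[xt Pt]]|/existsPn nex] :=
    boolP [exists t, r x t && P t]; last first.
  by exists x => // t xt; move: (nex t); rewrite xt.
apply: (IH t Pt); apply: leq_trans cx; apply: proper_card; apply/properP; split.
  by apply/fintype.subsetP => z; rewrite !inE; apply: tr.
by exists t; rewrite !inE ?irr.
Qed.

Lemma delta_inj (x y : L) : (forall j, delta j x = delta j y) -> x = y.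
Proof.
move=> xy; apply/le_anti/andP; split; apply: ji_decomp => j jx.
  by have := xy j; rewrite /delta jx; case: (_ <= y).
by have := xy j; rewrite /delta jx; case: (_ <= x).
Qed.

Lemma antilexP (r0 : rel (join_irr L)) (x y : L) :
  reflect (exists s, (delta s x < delta s y)%N /\
                     forall t, r0 s t -> delta t x = delta t y)
          (antilex r0 x y).
Proof.
apply: (iffP existsP) => -[s].
  case/andP=> sxy /forallP st; exists s; split=> // t rst.
  by have := st t; rewrite rst => /eqP.
case=> sxy st; exists s; rewrite sxy; apply/forallP => t.
by apply/implyP => /st ->.
Qed.

Lemma antilex_diff (r0 : rel (join_irr L)) (x y : L) :
  strict_linear r0 -> x != y ->
  exists2 s, delta s x != delta s y &
    forall t, r0 s t -> delta t x = delta t y.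
Proof.
move=> lin xy.
have [j xyj] : exists j, delta j x != delta j y.
  apply/existsP; apply: contraNT xy => /existsPn xy; apply/eqP/delta_inj => j.
  by have := xy j; rewrite negbK => /eqP.
have [s xys smax] := strict_linear_max (P := fun s => delta s x != delta s y)
  lin xyj.
by exists s => // t /smax; rewrite negbK => /eqP.
Qed.

Lemma antilex_linear (r0 : rel (join_irr L)) :
  linear_extension r0 -> linear_extension (antilex r0).
Proof.
move=> [lin ext]; case: (lin) => irr tr tot; split; first split.
- by move=> x; apply/antilexP => -[s []]; rewrite ltnn.
- move=> y x z /antilexP[s [sxy sP]] /antilexP[u [uyz uP]]; apply/antilexP.
  have [su|su] := eqVneq s u.
    subst u; exists s; split=> [|t rst]; first exact: ltn_trans uyz.
    by rewrite sP // uP.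
  case/orP: (tot _ _ su) => [rsu|rus].
    exists u; split=> [|t rut]; first by rewrite sP.
    by rewrite sP ?uP //; apply: tr rut.
  exists s; split=> [|t rst]; first by rewrite -(uP s).
  by rewrite sP ?uP //; apply: tr rst.
- move=> x y /(antilex_diff lin)[s]; rewrite neq_ltn => /orP[] lt sP.
    by apply/orP; left; apply/antilexP; exists s.
  by apply/orP; right; apply/antilexP; exists s; split=> // t /sP.
- move=> x y xy; have [s sxy sP] := antilex_diff lin (negbT (lt_eqF xy)).
  apply/antilexP; exists s; split=> //; move: sxy; rewrite neq_ltn /delta.
  case/orP=> //; have [sx|] := boolP (val s <= x); last by case: (_ <= y).
  by rewrite (le_trans sx (ltW xy)).
Qed.

Lemma natural_order_linear (r : rel L) :
  natural_order r -> linear_extension r.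
Proof.
move=> [r0 /antilex_linear ext rr0].
by rewrite (_ : r = antilex r0) //; apply/funext => x; apply/funext => y.
Qed.

End NaturalOrder.

Section Positive.
Context d (L : finTBDistrLatticeType d) d' (K : finTBDistrLatticeType d').

Definition nonminimal (f : L -> K) : {set L} :=
  [set x | [exists y : L, (y < x) && (f y == f x)]].

Definition diff_set (x : L) (S : {set L}) : L :=
  \join_(j : join_irr L | (val j <= x) && (val j \notin S)) val j.

(* The library's {tblmorphism L -> K} only records preservation of \bot and \top,
   not of meets and joins, hence this predicate. *)
Definition lattice_hom (f : L -> K) : Prop :=
  [/\ Order.meet_morphism f, Order.join_morphism f, f \bot = \bot
    & f \top = \top].

Definition positive (rL : rel L) (rK : rel K) (f : L -> K) : Prop :=
  forall x y : L,
    refl_clos rL (diff_set x (nonminimal f)) (diff_set y (nonminimal f)) ->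
    refl_clos rK (f x) (f y).

Definition surjective (f : L -> K) : Prop := forall y, exists x, f x = y.

Lemma nonminimalP (f : L -> K) (x : L) :
  reflect (exists2 y, y < x & f y = f x) (x \in nonminimal f).
Proof.
rewrite inE; apply: (iffP existsP) => [[y /andP[? /eqP ?]]|[y yx fyx]].
  by exists y.
by exists y; rewrite yx fyx eqxx.
Qed.

Lemma diff_set_le (x : L) (S : {set L}) : diff_set x S <= x.
Proof. by apply/joinsP => j /andP[]. Qed.

Lemma le_diff_set (x : L) (S : {set L}) (j : join_irr L) :
  val j <= x -> val j \notin S -> val j <= diff_set x S.
Proof.
by move=> jx jS; rewrite (joins_min (j := j)) ?jx.
Qed.

End Positive.

Section PositiveComp.
Context d1 (L : finTBDistrLatticeType d1).
Context d2 (K : finTBDistrLatticeType d2).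
Context d3 (M : finTBDistrLatticeType d3).
Variables (f : L -> K) (g : K -> M).
Hypothesis fH : lattice_hom f.
Let omorphI : {morph f : x y / x `&` y}. Proof. by case: fH. Qed.
Let omorphU : {morph f : x y / x `|` y}. Proof. by case: fH. Qed.
Let omorph0 : f \bot = \bot. Proof. by case: fH. Qed.
Let omorph1 : f \top = \top. Proof. by case: fH. Qed.
Let omorph_le : {homo f : x y / x <= y}.
Proof. by move=> x y /meet_idPl xy; rewrite -xy omorphI leIr. Qed.

Lemma diff_set_comp x : diff_set (diff_set x (nonminimal (g \o f)))
  (nonminimal f) = diff_set x (nonminimal (g \o f)).
Proof.
apply/le_anti; rewrite diff_set_le /=; apply/joinsP => j /andP[jx jN].
apply: le_diff_set; first exact: le_diff_set.
apply: contra jN => /nonminimalP[y yj fy]; apply/nonminimalP.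
by exists y => //=; rewrite fy.
Qed.

Lemma nonminimalN (h : L -> K) (x : L) : x \notin nonminimal h ->
  forall u, u <= x -> h u = h x -> u = x.
Proof.
move=> xN u ux hu; apply/eqP; apply: contraNT xN => nux; apply/nonminimalP.
by exists u => //; rewrite lt_neqAle nux.
Qed.

Lemma morph_ji (j : L) : surjective f -> join_irreducible j ->
  j \notin nonminimal f -> join_irreducible (f j).
Proof.
move=> fS /join_irrP[j0 jP] /nonminimalN jmin; apply/join_irrP; split.
  by rewrite -omorph0 => fj0; apply/j0/esym/jmin; rewrite ?le0x.
move=> a b; have [[u <-] [v <-]] := (fS a, fS b); rewrite -omorphU => fj.
have /esym : j `&` (u `|` v) = j.
  by apply: jmin; [exact: leIl | rewrite omorphI -fj meetxx].
rewrite meetUr => /jP[] ju; [left | right]; apply/le_anti/andP; split.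
- by rewrite {1}ju omorphI leIr.
- by rewrite fj omorphU leUl.
- by rewrite {1}ju omorphI leIr.
- by rewrite fj omorphU leUr.
Qed.

Lemma ji_lift (k : join_irr K) : surjective f ->
  exists2 j : join_irr L, f (val j) = val k &
    forall x, (val j <= x) = (val k <= f x).
Proof.
move=> fS; pose m := \meet_(x : L | val k <= f x) x.
have mP x : (m <= x) = (val k <= f x).
  apply/idP/idP => [mx|kx]; last exact: meets_inf.
  apply: le_trans (omorph_le mx).
  by rewrite /m; elim/big_ind: _ => [|a b ka kb|//];
    rewrite ?omorph1 ?lex1 // omorphI lexI ka kb.
have fm : f m = val k.
  apply/le_anti; rewrite -mP lexx andbT; have [x xk] := fS (val k).
  by rewrite -xk omorph_le // mP xk.
have mJ : join_irreducible m.
  have [k0 kP] := join_irrP _ (valP k); apply/join_irrP; split.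
    by move=> m0; apply: k0; rewrite -fm m0 omorph0.
  move=> a b mab; have : val k = f a `|` f b by rewrite -omorphU -mab fm.
  case/kP => ka; [left | right]; apply/le_anti/andP; split.
  - by rewrite mP ka.
  - by rewrite mab leUl.
  - by rewrite mP ka.
  - by rewrite mab leUr.
by exists (JoinIrr mJ).
Qed.

Lemma morph_diff_set x : surjective f ->
  f (diff_set x (nonminimal (g \o f))) = diff_set (f x) (nonminimal g).
Proof.
move=> fS; apply/le_anti/andP; split.
  rewrite /diff_set; elim/big_ind: _ => [|a b ha hb|j /andP[jx jN]].
  - by rewrite omorph0 le0x.
  - by rewrite omorphU leUx ha hb.
  have jNf : val j \notin nonminimal f.
    apply: contra jN => /nonminimalP[y yj fy]; apply/nonminimalP.
    by exists y => //=; rewrite fy.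
  apply: (le_diff_set (j := JoinIrr (morph_ji fS (valP j) jNf))) => /=.
    exact: omorph_le.
  apply: contra jN => /nonminimalP[z]; have [w <-] := fS z => wj gw.
  apply/nonminimalP; exists (w `&` val j); last first.
    by rewrite /= omorphI (meet_idPl (ltW wj)).
  rewrite lt_neqAle leIr andbT; apply: contraTneq wj => wj.
  by rewrite -{1}wj omorphI lt_leAnge leIl andbF.
apply/joinsP => k /andP[kx kN]; have [j fj jP] := ji_lift k fS.
rewrite -fj; apply: omorph_le; apply: le_diff_set; first by rewrite jP.
apply: contra kN => /nonminimalP[y yj gy]; apply/nonminimalP; exists (f y).
  rewrite -fj lt_leAnge omorph_le ?(ltW yj) //= fj -jP.
  by rewrite lt_geF.
by rewrite -fj.
Qed.

Lemma positive_comp (rL : rel L) (rK : rel K) (rM : rel M) : surjective f ->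
  positive rL rK f -> positive rK rM g -> positive rL rM (g \o f).
Proof.
move=> fS fP gP x y xy; apply: gP; rewrite -!(morph_diff_set _ fS).
by apply: fP; rewrite !diff_set_comp.
Qed.

Lemma lattice_hom_comp : lattice_hom g -> lattice_hom (g \o f).
Proof.
case=> gI gU g0 g1; split=> [x y|x y||] /=.
- by rewrite omorphI gI.
- by rewrite omorphU gU.
- by rewrite omorph0.
- by rewrite omorph1.
Qed.

Lemma surjective_comp : surjective f -> surjective g -> surjective (g \o f).
Proof.
by move=> fS gS z; have [y <-] := gS z; have [x <-] := fS y; exists x.
Qed.
End PositiveComp.

Lemma lattice_hom_id d (L : finTBDistrLatticeType d) :
  lattice_hom (idfun : L -> L).
Proof. by split. Qed.

Lemma positive_id d (L : finTBDistrLatticeType d) (r : rel L) :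
  positive r r idfun.
Proof.
have N0 (x : L) : diff_set x (nonminimal idfun) = x.
  apply/le_anti; rewrite diff_set_le /=; apply: ji_decomp => j jx.
  apply: le_diff_set => //; apply/nonminimalP => -[y yj yj'].
  by rewrite [y]yj' ltxx in yj.
by move=> x y; rewrite !N0.
Qed.

Record nat_lattice := NatLattice {
  nl_disp : Order.disp_t;
  nl_sort :> finTBDistrLatticeType nl_disp;
  nl_rel : rel nl_sort;
  nl_natural : natural_order nl_rel
}.

Record pos_hom (L K : nat_lattice) := PosHom {
  ph_fun :> L -> K;
  ph_hom : lattice_hom ph_fun;
  ph_surj : surjective ph_fun;
  ph_pos : positive (@nl_rel L) (@nl_rel K) ph_fun
}.

Lemma pos_hom_eq (L K : nat_lattice) (f g : pos_hom L K) : f =1 g -> f = g.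
Proof.
case: f g => f fH fS fP [g gH gS gP] /= /funext fg; subst g.
by congr PosHom.
Qed.

Definition pos_id (L : nat_lattice) : pos_hom L L :=
  @PosHom L L idfun (lattice_hom_id L) (fun y => ex_intro _ y erefl)
    (positive_id (r := @nl_rel L)).

Definition pos_comp (L K M : nat_lattice) (g : pos_hom K M) (f : pos_hom L K) :
    pos_hom L M :=
  @PosHom L M (g \o f) (lattice_hom_comp (ph_hom f) (ph_hom g))
    (surjective_comp (ph_surj f) (ph_surj g))
    (positive_comp (ph_hom f) (ph_surj f) (@ph_pos _ _ f) (@ph_pos _ _ g)).

Definition lattice_cat : category.
Proof.
refine (@Category nat_lattice pos_hom pos_id pos_comp _ _ _).
- by move=> *; apply: pos_hom_eq.
- by move=> *; apply: pos_hom_eq.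
- by move=> *; apply: pos_hom_eq.
Defined.

Record lin_poset := LinPoset {
  lp_disp : Order.disp_t;
  lp_sort :> finPOrderType lp_disp;
  lp_rel : rel lp_sort;
  lp_linear : linear_extension lp_rel
}.

Record lin_emb (P Q : lin_poset) := LinEmb {
  le_fun :> P -> Q;
  le_emb : {mono le_fun : x y / x <= y};
  le_lin : {homo le_fun : x y / lp_rel x y}
}.

Lemma lin_emb_eq (P Q : lin_poset) (f g : lin_emb P Q) : f =1 g -> f = g.
Proof.
case: f g => f fS fP [g gS gP] /= /funext fg; subst g.
by congr LinEmb.
Qed.

Definition lin_id (P : lin_poset) : lin_emb P P :=
  @LinEmb P P idfun (fun x y => erefl) (fun x y h => h).

Definition lin_comp (P Q R : lin_poset) (g : lin_emb Q R) (f : lin_emb P Q) :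
  lin_emb P R.
Proof.
refine (@LinEmb P R (g \o f) _ _).
- by move=> x y /=; rewrite !le_emb.
- by move=> x y xy /=; do 2!apply: le_lin.
Defined.

Definition poset_cat : category.
Proof.
refine (@Category lin_poset lin_emb lin_id lin_comp _ _ _).
- by move=> *; apply: lin_emb_eq.
- by move=> *; apply: lin_emb_eq.
- by move=> *; apply: lin_emb_eq.
Defined.

Definition J_rel (L : nat_lattice) : rel (join_irr L) :=
  fun x y => nl_rel (val x) (val y).

Lemma J_rel_linear (L : nat_lattice) : linear_extension (@J_rel L).
Proof.
have [[irr tr tot] ext] := natural_order_linear (@nl_natural L).
split; first split.
- by move=> x; apply: irr.
- by move=> y x z; apply: tr.
- by move=> x y xy; apply: tot.
- by move=> x y xy; apply: ext.
Qed.

Definition J_obj (L : nat_lattice) : lin_poset := LinPoset (@J_rel_linear L).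

(* The value is an element of L; that it is join-irreducible is not built in. *)
Definition J_map d (L : finTBDistrLatticeType d) d'
    (K : finTBDistrLatticeType d') (f : L -> K) (y : join_irr K) : L :=
  \meet_(x in f @^-1: [set z | val y <= z]) x.

(* Makes {set Q} canonically a lattice under inclusion. *)
Import Order.DefaultSetSubsetOrder.

Section DownSets.
Context d (Q : finPOrderType d).

Definition is_downset (U : {set Q}) : bool :=
  [forall p : Q, forall q : Q, (p <= q) && (q \in U) ==> (p \in U)].

Record downset := DownSet {
  ds_val :> {set Q};
  ds_valP : is_downset ds_val
}.

HB.instance Definition _ := [isSub for ds_val].
HB.instance Definition _ := [Finite of downset by <:].

Lemma is_downsetP (U : {set Q}) :
  reflect (forall p q : Q, p <= q -> q \in U -> p \in U) (is_downset U).
Proof.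
apply: (iffP forallP) => [UP p q pq qU|UP p].
  by have /forallP/(_ q) := UP p; rewrite pq qU.
by apply/forallP => q; apply/implyP => /andP[]; apply: UP.
Qed.

Fact downset_closed_meet : Order.ClosedPredicates.meet_closed is_downset.
Proof.
move=> U V /is_downsetP UP /is_downsetP VP; apply/is_downsetP => p q pq.
by rewrite !inE => /andP[/(UP _ _ pq)-> /(VP _ _ pq)].
Qed.

Fact downset_closed_join : Order.ClosedPredicates.join_closed is_downset.
Proof.
move=> U V /is_downsetP UP /is_downsetP VP; apply/is_downsetP => p q pq.
by rewrite !inE => /orP[/(UP _ _ pq)->|/(VP _ _ pq)->]; rewrite ?orbT.
Qed.

Fact downset_closed_bot : (\bot : {set Q}) \in is_downset.
Proof. by apply/is_downsetP => p q _; rewrite inE. Qed.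

Fact downset_closed_top : (\top : {set Q}) \in is_downset.
Proof. by apply/is_downsetP => p q _; rewrite !inE. Qed.

HB.instance Definition _ :=
  Order.SubChoice_isTBSubLattice.Build _ _ _ Order.SetSubsetOrder.subset_display downset
    downset_closed_meet downset_closed_join
    downset_closed_bot downset_closed_top.

Lemma meet_downset (U V : downset) :
  ds_val (U `&` V) = ds_val U :&: ds_val V.
Proof. by []. Qed.

Lemma join_downset (U V : downset) :
  ds_val (U `|` V) = ds_val U :|: ds_val V.
Proof. by []. Qed.

Lemma bot_downset : ds_val (\bot : downset) = set0.
Proof. by []. Qed.

Lemma top_downset : ds_val (\top : downset) = setT.
Proof. by []. Qed.

Fact downset_meetUl :
  left_distributive (Order.meet : downset -> downset -> downset) Order.join.
Proof. by move=> U V W; apply: val_inj; exact: setIUl. Qed.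

HB.instance Definition _ :=
  Order.Lattice_Meet_isDistrLattice.Build Order.SetSubsetOrder.subset_display
    downset downset_meetUl.

Definition principal (q : Q) : {set Q} := [set p : Q | p <= q].

Fact principal_downset q : is_downset (principal q).
Proof.
by apply/is_downsetP => p p' pp'; rewrite !inE; apply: le_trans.
Qed.

Definition ds_principal q : downset := DownSet (principal_downset q).

Lemma le_downset (U V : downset) :
  (U <= V) = (ds_val U \subset ds_val V).
Proof. by []. Qed.

Lemma le_principal q (U : downset) : (ds_principal q <= U) = (q \in ds_val U).
Proof.
rewrite le_downset; apply/fintype.subsetP/idP => [|qU p].
  by apply; rewrite inE.
by rewrite inE => pq; apply: (is_downsetP _ (ds_valP U)) pq qU.
Qed.

Lemma principal_ji q : join_irreducible (ds_principal q).
Proof.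
apply/join_irrP; split=> [|U V qUV].
  move=> /(congr1 ds_val)/setP/(_ q).
  by rewrite bot_downset !inE lexx.
have : q \in ds_val (U `|` V) by rewrite -le_principal qUV.
rewrite join_downset inE => /orP[]; rewrite -le_principal => qU;
  [left | right]; apply/le_anti; rewrite qU /= qUV ?leUl ?leUr //.
Qed.

Lemma ji_principal (A : join_irr downset) : exists q, val A = ds_principal q.
Proof.
have [|q _ ->] := join_irr_join (P := fun q => q \in ds_val (val A))
  (F := ds_principal) (valP A); last by exists q.
apply/le_anti/andP; split; last first.
  by apply/joinsP => q; rewrite le_principal.
rewrite le_downset; apply/fintype.subsetP => q qA.
by rewrite -le_principal (joins_min (j := q)).
Qed.

Lemma principal_inj p q : principal p = principal q -> p = q.
Proof.
move=> pq; apply/le_anti/andP; split.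
  by have : p \in principal q; [rewrite -pq inE | rewrite inE].
by have : q \in principal p; [rewrite pq inE | rewrite inE].
Qed.

(* Every join-irreducible of the lattice of down-sets is principal
   ([ji_principal]), so this relates all of them. *)
Definition transfer (r : rel Q) : rel (join_irr downset) := fun A B =>
  [exists p : Q, exists q : Q,
    [&& ds_val (val A) == principal p, ds_val (val B) == principal q & r p q]].

Lemma transferP (r : rel Q) (A B : join_irr downset) p q :
  val A = ds_principal p -> val B = ds_principal q -> transfer r A B = r p q.
Proof.
rewrite /transfer => -> ->; apply/existsP/idP => [[p']|pq].
  by case/existsP => q' /and3P[/eqP/principal_inj<- /eqP/principal_inj<-].
by exists p; apply/existsP; exists q; rewrite !eqxx.
Qed.

Lemma transfer_linear (r : rel Q) :
  linear_extension r -> linear_extension (transfer r).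
Proof.
move=> [[irr tr tot] ext]; split; first split.
- by move=> A; have [p Ap] := ji_principal A; rewrite (transferP r Ap Ap).
- move=> B A C; have [p Ap] := ji_principal A; have [q Bq] := ji_principal B.
  have [u Cu] := ji_principal C.
  rewrite (transferP r Ap Bq) (transferP r Bq Cu) (transferP r Ap Cu).
  exact: tr.
- move=> A B AB; have [p Ap] := ji_principal A; have [q Bq] := ji_principal B.
  rewrite (transferP r Ap Bq) (transferP r Bq Ap) tot //.
  by apply: contra_neq AB => pq; apply: val_inj; rewrite Ap Bq pq.
- move=> A B AB; have [p Ap] := ji_principal A; have [q Bq] := ji_principal B.
  rewrite (transferP r Ap Bq); apply: ext; move: AB.
  rewrite -lt_val Ap Bq !lt_def le_principal inE => /andP[ne ->].
  by rewrite andbT; apply: contra_neq ne => ->.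
Qed.

End DownSets.

Definition O_rel (Q : lin_poset) : rel (downset Q) :=
  antilex (transfer (@lp_rel Q)).

Fact O_rel_natural (Q : lin_poset) : natural_order (@O_rel Q).
Proof.
by exists (transfer (@lp_rel Q)) => //; apply/transfer_linear/lp_linear.
Qed.

Definition O_obj (Q : lin_poset) : nat_lattice := NatLattice (@O_rel_natural Q).

Definition O_map d (P : finPOrderType d) d' (Q : finPOrderType d')
    (phi : P -> Q) (U : downset Q) : {set P} :=
  phi @^-1: ds_val U.

(* Main.v *)
Require Import Defs.
From mathcomp Require Import all_boot all_order.

Set Implicit Arguments.
Unset Strict Implicit.
Unset Printing Implicit Defensive.

Import Order.TTheory.
Local Open Scope order_scope.

(** A surjective homomorphism [f : L -> K] of finite distributive lattices has
    a lower adjoint, which restricts to [J(f)] on the join-irreducibles of [K]: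
    [J(f) y <= x] iff [y <= f x]. The values of [J(f)] lie outside [N(f)], so
    testing positivity of [f] on them shows that [J(f)] preserves the linear
    orders. Conversely, for an embedding [phi], [U - N(O(phi))] is the image of
    [O(phi) U] under the lower adjoint of [O(phi)], which sends [V] to the
    down-closure of [phi V]; since [phi] preserves the linear orders, this
    adjoint preserves the antilexicographic ones, and [O(phi)] is positive. A
    natural order is the antilexicographic extension of its own restriction to
    the join-irreducibles, so Birkhoff's isomorphisms [x |-> {j | j <= x}] and
    [p |-> {q | q <= p}] respect the linear orders. *)

(** * Strict linear orders *)

Lemma strict_linear_homo_mono (S T : eqType) (r : rel S) (r' : rel T)
    (f : S -> T) : strict_linear r -> strict_linear r' ->
  {homo f : x y / r x y >-> r' x y} -> {mono f : x y / r x y >-> r' x y}.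
Proof.
move=> [_ _ tot] [irr' tr' _] fr x y; apply/idP/idP; last exact: fr.
have [->|/tot/orP[]//] := eqVneq x y; first by rewrite irr'.
by move=> /fr yx /(tr' _ _ _ yx); rewrite irr'.
Qed.

(** Turns positivity into its contrapositive, an implication between strict relations. *)
Lemma strict_linear_refl_clos (T : eqType) (r : rel T) (x y : T) :
  strict_linear r -> refl_clos r x y = ~~ r y x.
Proof.
move=> [irr tr tot]; rewrite /refl_clos.
have [->|xy] := eqVneq x y; first by rewrite irr.
apply/idP/idP => [|/negPf yx]; last by have := tot _ _ xy; rewrite yx orbF.
by move=> rxy; apply/negP => /(tr _ _ _ rxy); rewrite irr.
Qed.

(** * Natural orders and their restrictions to join-irreducibles *)

Section NaturalOrders.
Context d (L : finTBDistrLatticeType d).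

Lemma antilex_leP (r0 : rel (join_irr L)) (x y : L) :
  reflect (exists s : join_irr L, [/\ ~~ (val s <= x), val s <= y &
             forall t : join_irr L, r0 s t -> (val t <= x) = (val t <= y)])
          (antilex r0 x y).
Proof.
apply: (iffP (antilexP _ _ _)) => -[s].
  rewrite /delta => -[sxy st]; exists s; split=> [||t /st].
  - by case: (val s <= x) sxy => //; case: (_ <= _).
  - by case: (val s <= y) sxy => //; case: (_ <= _).
  - by case: (val t <= x); case: (val t <= y).
by case=> /negPf sx sy st; exists s; rewrite /delta sx sy; split=> // t /st ->.
Qed.

(** Both sides are strict linear orders, so [r0 j k] only has to imply the left side. The witness is
    [k]: a join-irreducible never lies below one that precedes it in [r0]. *)
Lemma antilex_ji (r0 : rel (join_irr L)) (j k : join_irr L) :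
  linear_extension r0 -> antilex r0 (val j) (val k) = r0 j k.
Proof.
move=> ext; have [lin_a _] := antilex_linear ext.
have [lin0 lt0] := ext; have [irr tr _] := lin0.
apply: (strict_linear_homo_mono (f := val) lin0 lin_a) => {}j {}k jk.
have above (s t : join_irr L) : r0 s t -> val t <= val s = false.
  move=> st; apply/negP; rewrite -[_ <= _]/(t <= s) le_eqVlt => /orP[/eqP ts|].
    by rewrite ts irr in st.
  by move=> /lt0/(tr _ _ _ st); rewrite irr.
apply/antilex_leP; exists k; rewrite above //; split=> // t kt.
by rewrite !above //; apply: tr kt.
Qed.

End NaturalOrders.

(** By [antilex_ji], any [r0] witnessing naturality coincides with [J_rel]. *)
Lemma nl_relE (L : nat_lattice) : @nl_rel L =2 antilex (@J_rel L).
Proof.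
have [r0 ext rE] := @nl_natural L.
have JE : @J_rel L =2 r0 by move=> j k; rewrite /J_rel rE antilex_ji.
move=> x y; rewrite rE; apply/antilex_leP/antilex_leP => -[s [sx sy st]];
  by exists s; split=> // t; rewrite ?JE => rst; apply: st; rewrite ?JE.
Qed.

Lemma nl_strict_linear (L : nat_lattice) : strict_linear (@nl_rel L).
Proof. by have [] := natural_order_linear (@nl_natural L). Qed.

(** * The lower adjoint of a surjective homomorphism *)

Section LatticeHom.
Context d (L : finTBDistrLatticeType d) d' (K : finTBDistrLatticeType d').
Variable f : L -> K.
Hypothesis fH : lattice_hom f.

(** The [j] of [ji_lift] is the least element of the set whose meet is [J_map f k]: it is a member
    because [f j = k], and a lower bound by the adjunction. *)
Lemma J_map_lift (k : join_irr K) : surjective f ->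
  exists2 j : join_irr L, val j = J_map f k &
    f (val j) = val k /\ forall x, (val j <= x) = (val k <= f x).
Proof.
move=> fS; have [j fj jP] := ji_lift fH k fS; exists j => //.
apply/le_anti/andP; split; last by apply: meets_inf; rewrite !inE fj.
by apply/meetsP => x; rewrite !inE jP.
Qed.

Lemma J_map_ji (k : join_irr K) : surjective f -> join_irreducible (J_map f k).
Proof. by move=> fS; have [j <- _] := J_map_lift k fS; apply: valP. Qed.

Lemma le_J_map (k : join_irr K) x : surjective f ->
  (J_map f k <= x) = (val k <= f x).
Proof. by move=> fS; have [j <- [_ ->]] := J_map_lift k fS. Qed.

Lemma J_mapK (k : join_irr K) : surjective f -> f (J_map f k) = val k.
Proof. by move=> fS; have [j <- []] := J_map_lift k fS. Qed.

(** By the adjunction, every [y] with [f y = k] lies above [J_map f k]. *)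
Lemma J_map_minimal (k : join_irr K) : surjective f ->
  J_map f k \notin nonminimal f.
Proof.
move=> fS; apply/nonminimalP => -[y ltyk fy].
have : J_map f k <= y by rewrite le_J_map // fy J_mapK.
by rewrite (lt_geF ltyk).
Qed.

End LatticeHom.

(** * Positivity of injective maps *)

Section InjectiveMaps.
Context d (L : finTBDistrLatticeType d) d' (K : finTBDistrLatticeType d').
Variable f : L -> K.
Hypothesis fI : injective f.

(** An injective [f] has empty [nonminimal f]. *)
Lemma diff_set_inj x : diff_set x (nonminimal f) = x.
Proof.
apply/le_anti; rewrite diff_set_le /=; apply: ji_decomp => j jx.
apply: le_diff_set => //; apply/nonminimalP => -[y yj /fI yE].
by rewrite yE ltxx in yj.
Qed.

Lemma positive_inj (rL : rel L) (rK : rel K) :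
  {homo f : x y / rL x y >-> rK x y} -> positive rL rK f.
Proof.
move=> fr x y; rewrite !diff_set_inj => /orP[/eqP ->|/fr xy]; apply/orP.
  by left.
by right.
Qed.

End InjectiveMaps.

Lemma diff_set_minimal d (L : finTBDistrLatticeType d) (S : {set L})
    (j : join_irr L) : val j \notin S -> diff_set (val j) S = val j.
Proof. by move=> jS; apply/le_anti; rewrite diff_set_le le_diff_set. Qed.

(** * Points as join-irreducible down-sets *)

Section PrincipalJoinIrreducibles.
Context d (P : finPOrderType d).

Definition ji_of_point (p : P) : join_irr (downset P) :=
  JoinIrr (principal_ji p).

Lemma ji_of_point_emb : {mono ji_of_point : x y / x <= y}.
Proof. by move=> p q; rewrite -Order.le_val /= le_principal inE. Qed.

Lemma ji_of_point_surj (A : join_irr (downset P)) :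
  exists p, ji_of_point p = A.
Proof. by have [p Ap] := ji_principal A; exists p; apply: val_inj. Qed.

Lemma transfer_ji_of_point (r : rel P) p q :
  transfer r (ji_of_point p) (ji_of_point q) = r p q.
Proof.
exact: (@transferP _ _ r (ji_of_point p) (ji_of_point q) p q erefl erefl).
Qed.

End PrincipalJoinIrreducibles.

(** * Bijective morphisms are isomorphisms *)

Lemma pos_hom_iso (L K : lattice_cat) (f : pos_hom L K) :
  injective f -> isomorphism (C := lattice_cat) (a := L) (b := K) f.
Proof.
move=> fI; have [fM fU f0 f1] := ph_hom f.
have fsurj y : exists x, f x == y by have [x <-] := ph_surj f y; exists x.
pose g y := xchoose (fsurj y).
have gK : cancel g f by move=> y; apply/eqP/(xchooseP (fsurj y)).
have fK : cancel f g by move=> x; apply: fI; rewrite gK.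
have gH : lattice_hom g.
  by split=> [x y|x y||]; apply: fI; rewrite ?fM ?fU ?f0 ?f1 !gK.
have gP : positive (@nl_rel K) (@nl_rel L) g.
  apply: (positive_inj (can_inj gK)) => x y xy.
  (* Positivity at the swapped pair, read contrapositively, says that [f] reflects the strict
     order. *)
  have := @ph_pos _ _ f (g y) (g x); rewrite !(diff_set_inj fI) !gK.
  rewrite !strict_linear_refl_clos; try exact: nl_strict_linear.
  by rewrite xy => /contraT; apply.
have gS : surjective g by move=> x; exists (f x).
by exists (PosHom gH gS gP); split; apply: pos_hom_eq.
Qed.

Lemma lin_emb_iso (P Q : poset_cat) (f : lin_emb P Q) :
  (forall q, exists p, f p = q) ->
  isomorphism (C := poset_cat) (a := P) (b := Q) f.
Proof.
move=> fS; have fsurj y : exists x, f x == y.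
  by have [x <-] := fS y; exists x.
pose g y := xchoose (fsurj y).
have gK : cancel g f by move=> y; apply/eqP/(xchooseP (fsurj y)).
have fK : cancel f g.
  by move=> x; apply/le_anti; rewrite -!(le_emb f) !gK lexx.
have gM : {mono g : x y / x <= y} by move=> x y; rewrite -(le_emb f) !gK.
have gL : {homo g : x y / lp_rel x y}.
  have [linP _] := @lp_linear P; have [linQ _] := @lp_linear Q.
  have fE := strict_linear_homo_mono linP linQ (@le_lin _ _ f).
  by move=> x y xy; rewrite -fE !gK.
by exists (LinEmb gM gL); split; apply: lin_emb_eq.
Qed.

(** * The functor from lattices to posets *)

Definition J_fun (L K : nat_lattice) (f : pos_hom L K) (y : join_irr K) :
    join_irr L :=
  JoinIrr (J_map_ji (ph_hom f) y (ph_surj f)).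

Lemma le_J_fun (L K : nat_lattice) (f : pos_hom L K) (y : join_irr K) (x : L) :
  (val (J_fun f y) <= x) = (val y <= f x).
Proof. exact: le_J_map (ph_hom f) _ _ (ph_surj f). Qed.

Lemma J_funK (L K : nat_lattice) (f : pos_hom L K) (y : join_irr K) :
  f (val (J_fun f y)) = val y.
Proof. exact: J_mapK (ph_hom f) _ (ph_surj f). Qed.

Lemma J_fun_emb (L K : nat_lattice) (f : pos_hom L K) :
  {mono J_fun f : x y / x <= y}.
Proof. by move=> x y; rewrite -!Order.le_val le_J_fun J_funK. Qed.

Lemma J_fun_lin (L K : nat_lattice) (f : pos_hom L K) :
  {homo J_fun f : x y / J_rel x y}.
Proof.
move=> x y; rewrite /J_rel => xy.
(* The pair is swapped since the contrapositive is used. Both elements lie outside [nonminimal f],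
   so [diff_set] fixes them. *)
have := @ph_pos _ _ f (val (J_fun f y)) (val (J_fun f x)).
rewrite !diff_set_minimal; try exact: J_map_minimal (ph_hom f) _ (ph_surj f).
rewrite !J_funK !strict_linear_refl_clos; try exact: nl_strict_linear.
by rewrite xy => /contraT; apply.
Qed.

Definition J_hom (L K : nat_lattice) (f : pos_hom L K) :
    lin_emb (J_obj K) (J_obj L) :=
  @LinEmb (J_obj K) (J_obj L) (J_fun f) (@J_fun_emb _ _ f) (@J_fun_lin _ _ f).

(** Lets equalities of [J_fun] values be checked through the adjunction [le_J_fun] instead of
    through meets. *)
Lemma eq_join_irr d (L : finTBDistrLatticeType d) (j k : join_irr L) :
  (forall x, (val j <= x) = (val k <= x)) -> j = k.
Proof.
move=> jk; apply/val_inj/le_anti.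
by rewrite jk lexx -jk lexx.
Qed.

Lemma J_hom_id (L : lattice_cat) : J_hom (pos_id L) = lin_id (J_obj L).
Proof.
by apply: lin_emb_eq => y; apply: eq_join_irr => x; rewrite le_J_fun.
Qed.

Lemma J_hom_comp (L K M : lattice_cat) (g : pos_hom K M) (f : pos_hom L K) :
  J_hom (pos_comp g f) = lin_comp (J_hom f) (J_hom g).
Proof.
by apply: lin_emb_eq => y; apply: eq_join_irr => x; rewrite !le_J_fun.
Qed.

Definition J_functor : contrafunctor lattice_cat poset_cat J_obj :=
  @ContraFunctor lattice_cat poset_cat J_obj J_hom J_hom_id J_hom_comp.

(** * The functor from posets to lattices *)

Section Embedding.
Variables (P Q : lin_poset) (phi : lin_emb P Q).

Lemma O_map_downset (U : downset Q) : is_downset (O_map phi U).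
Proof.
apply/is_downsetP => p q; rewrite !inE -(le_emb phi).
exact: (is_downsetP _ (ds_valP U)).
Qed.

Definition O_fun (U : downset Q) : downset P := DownSet (O_map_downset U).

Lemma in_O_fun (U : downset Q) p :
  (p \in ds_val (O_fun U)) = (phi p \in ds_val U).
Proof. by rewrite inE. Qed.

Lemma O_fun_hom : lattice_hom O_fun.
Proof.
by split=> [U V|U V||]; apply/val_inj/setP => p; rewrite !inE.
Qed.

Lemma O_inv_downset (V : downset P) :
  is_downset [set q | [exists p, (p \in ds_val V) && (q <= phi p)]].
Proof.
apply/is_downsetP => q' q qq'; rewrite !inE => /existsP[p /andP[pV qp]].
by apply/existsP; exists p; rewrite pV (le_trans qq').
Qed.

(** The lower adjoint of [O_fun], by [le_O_inv]. *)
Definition O_inv (V : downset P) : downset Q := DownSet (O_inv_downset V).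

Lemma in_O_inv (V : downset P) q :
  reflect (exists2 p, p \in ds_val V & q <= phi p) (q \in ds_val (O_inv V)).
Proof.
rewrite inE; apply: (iffP existsP) => [[p /andP[]]|[p pV qp]]; exists p => //.
by rewrite pV.
Qed.

(** As [phi] reflects the order, the down-closure of [phi V] contains no point [phi p] with [p]
    outside [V]. *)
Lemma O_invK : cancel O_inv O_fun.
Proof.
move=> V; apply/val_inj/setP => p; rewrite in_O_fun.
apply/in_O_inv/idP => [[p' p'V]|pV]; last by exists p.
by rewrite le_emb => /(is_downsetP _ (ds_valP V)); apply.
Qed.

Lemma le_O_inv (V : downset P) (U : downset Q) :
  (O_inv V <= U) = (V <= O_fun U).
Proof.
rewrite !le_downset; apply/fintype.subsetP/fintype.subsetP => sub => [p pV|q].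
  by rewrite in_O_fun; apply/sub/in_O_inv; exists p.
case/in_O_inv => p /sub; rewrite in_O_fun => pU.
by move=> /(is_downsetP _ (ds_valP U)); apply.
Qed.

Lemma O_fun_surj : surjective O_fun.
Proof. by move=> V; exists (O_inv V); apply: O_invK. Qed.

(** The right side is the least down-set with the same image as [U]. It contains every minimal
    join-irreducible below [U], and it is generated by the points [phi p] in [U], whose principal
    down-sets are minimal. *)
Lemma diff_set_O_fun (U : downset Q) :
  diff_set U (nonminimal O_fun) = O_inv (O_fun U).
Proof.
apply/le_anti/andP; split.
  apply/joinsP => j /andP[jU jN].
  (* The left side lies below [j] and has the same image, so minimality of [j] forces equality. *)
  have <- : O_inv (O_fun (val j)) = val j.
    by apply: nonminimalN jN _ _ _; rewrite ?le_O_inv // O_invK.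
  rewrite le_O_inv O_invK; have [fI _ _ _] := O_fun_hom.
  by rewrite -(meet_idPl jU) fI leIr.
rewrite le_O_inv le_downset; apply/fintype.subsetP => p; rewrite !in_O_fun.
rewrite -!le_principal => pU.
apply: (le_diff_set (j := ji_of_point (phi p))) => //.
(* A down-set [V] strictly below the principal one misses [phi p], so its preimage misses [p]. *)
apply/nonminimalP => -[V ltVp /(congr1 (@ds_val _ _))/setP/(_ p)].
by rewrite !in_O_fun -!le_principal /= lexx (lt_geF ltVp).
Qed.

End Embedding.

Lemma O_relP (Q : lin_poset) (U V : downset Q) :
  reflect (exists q, [/\ q \notin ds_val U, q \in ds_val V &
             forall t, lp_rel q t -> (t \in ds_val U) = (t \in ds_val V)])
          (O_rel U V).
Proof.
apply: (iffP (antilex_leP _ _ _)) => [[s]|[q [qU qV qP]]].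
  have [q <-] := ji_of_point_surj s; rewrite !le_principal => -[qU qV qP].
  exists q; split=> // t qt; have := qP (ji_of_point t).
  by rewrite transfer_ji_of_point !le_principal; apply.
exists (ji_of_point q); rewrite !le_principal; split=> // s.
have [t <-] := ji_of_point_surj s.
by rewrite transfer_ji_of_point !le_principal; apply: qP.
Qed.

Lemma O_inv_lin (P Q : lin_poset) (phi : lin_emb P Q) :
  {homo O_inv phi : U V / O_rel U V}.
Proof.
have [linP _] := @lp_linear P; have [linQ extQ] := @lp_linear Q.
have phiE := strict_linear_homo_mono linP linQ (@le_lin _ _ phi).
have [_ trQ _] := linQ.
move=> U V /O_relP[p [pU pV pP]]; apply/O_relP; exists (phi p).
rewrite -!in_O_fun !O_invK; split=> // t pt.
(* Such a [p'] comes after [p]: [phi p] precedes [t], the linear order extends [<=], and [phi]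
   reflects the linear order. *)
have UV p' : t <= phi p' -> (p' \in ds_val U) = (p' \in ds_val V).
  move=> tp'; apply: pP; rewrite -phiE; move: tp'.
  by rewrite le_eqVlt => /orP[/eqP <- //|/extQ]; apply: trQ.
by apply/in_O_inv/in_O_inv => -[p' p'U tp']; exists p'; rewrite // ?UV // -UV.
Qed.

(** Contrapositively, this is [O_inv_lin] applied to [O_fun V] and [O_fun U]. *)
Lemma O_fun_pos (P Q : lin_poset) (phi : lin_emb P Q) :
  positive (@O_rel Q) (@O_rel P) (O_fun phi).
Proof.
move=> U V; rewrite !diff_set_O_fun.
rewrite !strict_linear_refl_clos; first by apply: contra; apply: O_inv_lin.
  exact: nl_strict_linear (O_obj P).
exact: nl_strict_linear (O_obj Q).
Qed.

Definition O_hom (P Q : lin_poset) (phi : lin_emb P Q) :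
    pos_hom (O_obj Q) (O_obj P) :=
  @PosHom (O_obj Q) (O_obj P) (O_fun phi) (O_fun_hom phi) (@O_fun_surj _ _ phi)
    (@O_fun_pos _ _ phi).

Lemma O_hom_id (P : poset_cat) : O_hom (lin_id P) = pos_id (O_obj P).
Proof.
by apply: pos_hom_eq => U; apply/val_inj/setP => p; rewrite in_O_fun.
Qed.

Lemma O_hom_comp (P Q R : poset_cat) (g : lin_emb Q R) (f : lin_emb P Q) :
  O_hom (lin_comp g f) = pos_comp (O_hom f) (O_hom g).
Proof.
by apply: pos_hom_eq => U; apply/val_inj/setP => p; rewrite !in_O_fun.
Qed.

Definition O_functor : contrafunctor poset_cat lattice_cat O_obj :=
  @ContraFunctor poset_cat lattice_cat O_obj O_hom O_hom_id O_hom_comp.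

(** * Birkhoff's isomorphism for lattices *)

Section LatticeUnit.
Variable L : nat_lattice.

Lemma ji_below_downset (x : L) : is_downset [set j : join_irr L | val j <= x].
Proof.
by apply/is_downsetP => j k; rewrite !inE -Order.le_val; apply: le_trans.
Qed.

Definition ji_below (x : L) : downset (join_irr L) :=
  DownSet (ji_below_downset x).

Lemma in_ji_below x j : (j \in ds_val (ji_below x)) = (val j <= x).
Proof. by rewrite inE. Qed.

(** Join-irreducibles are join-prime by distributivity: if [j] lies below the join, it is the join
    of its meets with [x] and [y], hence equal to one of them. *)
Lemma ji_leU (j : join_irr L) (x y : L) :
  (val j <= x `|` y) = (val j <= x) || (val j <= y).
Proof.
apply/idP/orP => [/meet_idPl/esym|[] jx]; last 2 first.
- by rewrite lexU2 // jx.
- by rewrite lexU2 // jx orbT.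
rewrite meetUr; have [_ jP] := join_irrP _ (valP j).
by move=> /jP[] ->; [left | right]; rewrite leIr.
Qed.

Lemma ji_below_hom : lattice_hom ji_below.
Proof.
split=> [x y|x y||]; apply/val_inj/setP => j; rewrite !inE.
- by rewrite lexI.
- by rewrite ji_leU.
- by rewrite lex0; have [/eqP/negPf] := join_irrP _ (valP j).
- by rewrite lex1.
Qed.

Lemma ji_below_inj : injective ji_below.
Proof.
move=> x y /(congr1 (@ds_val _ _))/setP xy; apply/le_anti/andP.
by split; apply: ji_decomp => j; have := xy j; rewrite !in_ji_below => ->.
Qed.

(** The preimage of [U] is the join of its members; by primeness, a join-irreducible below it lies
    below some member. *)
Lemma ji_below_surj : surjective ji_below.
Proof.
move=> U; exists (\join_(j in ds_val U) val j); apply/val_inj/setP => j.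
rewrite in_ji_below; apply/idP/idP => [|jU]; last exact: (joins_min (j := j)).
elim/big_rec: _ => [|k x kU IH].
  by rewrite lex0; have [/eqP/negPf ->] := join_irrP _ (valP j).
rewrite ji_leU => /orP[jk|/IH//].
by apply: (is_downsetP _ (ds_valP U)) kU; rewrite -Order.le_val.
Qed.

(** By [nl_relE] both orders are antilexicographic over [J_rel], so the same witness [s] serves. *)
Lemma ji_below_pos : positive (@nl_rel L) (@O_rel (J_obj L)) ji_below.
Proof.
apply: (positive_inj ji_below_inj) => x y; rewrite nl_relE.
move=> /antilex_leP[s [sx sy sP]]; apply/O_relP; exists s.
by rewrite !in_ji_below; split=> // t /sP; rewrite !in_ji_below.
Qed.

Definition lattice_unit : pos_hom L (O_obj (J_obj L)) :=
  @PosHom L (O_obj (J_obj L)) ji_below ji_below_hom ji_below_surj ji_below_pos.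

End LatticeUnit.

(** * Birkhoff's isomorphism for posets *)

Section PosetUnit.
Variable P : lin_poset.

Lemma ji_of_point_lin (p q : P) :
  lp_rel p q -> @J_rel (O_obj P) (ji_of_point p) (ji_of_point q).
Proof.
rewrite -transfer_ji_of_point -antilex_ji //.
exact/transfer_linear/lp_linear.
Qed.

Definition poset_unit : lin_emb P (J_obj (O_obj P)) :=
  @LinEmb P (J_obj (O_obj P)) (@ji_of_point _ P)
    (@ji_of_point_emb _ P) ji_of_point_lin.

End PosetUnit.

Theorem theorem3p7 :
  exists (J' : contrafunctor lattice_cat poset_cat J_obj)
         (O' : contrafunctor poset_cat lattice_cat O_obj),
    [/\ forall (L K : nat_lattice) (f : pos_hom L K) (y : join_irr K),
          ji_val ((cmap J' f : lin_emb (J_obj K) (J_obj L)) y) = J_map f y,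
        forall (P Q : lin_poset) (phi : lin_emb P Q) (U : downset Q),
          ds_val ((cmap O' phi : pos_hom (O_obj Q) (O_obj P)) U) = O_map phi U,
        naturally_isomorphic (id_functor lattice_cat) (contra_comp O' J')
      & naturally_isomorphic (id_functor poset_cat) (contra_comp J' O')].
Proof.
exists J_functor, O_functor; split=> //.
- exists lattice_unit; split=> [L K f|L]; last first.
    exact: (@pos_hom_iso _ _ (lattice_unit L) (@ji_below_inj L)).
  apply: pos_hom_eq => x; apply/val_inj/setP => y.
  (* Membership of [y] turns naturality into the adjunction between [J_fun f] and [f]. *)
  by rewrite in_O_fun !in_ji_below; apply: le_J_fun.
- exists poset_unit; split=> [P Q phi|P]; last first.
    exact: (@lin_emb_iso _ _ (poset_unit P) (@ji_of_point_surj _ P)).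
  apply: lin_emb_eq => p; apply: eq_join_irr => U.
  (* Both join-irreducibles lie below [U] exactly when [phi p] belongs to [U]. *)
  transitivity (ds_principal p <= O_fun phi U).
    exact: (le_J_fun (O_hom phi) (ji_of_point p)).
  by rewrite /= !le_principal in_O_fun.
Qed.
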